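(* Let $\Lambda$ be an invertible antisymmetric real $n\times n$ matrix, $H:\mathbb{R}^n\to\mathbb{R}$ smooth, $h>0$, and let $\mathcal{A}=(a_{ij})_{i,j=1}^s$, $(b_i)_{i=1}^s$ be the coefficients of an $s$-stage Runge-Kutta method. Suppose $\mathcal{A}$ is invertible and $q,p\in\mathbb{R}^n$ satisfy $p=-\tfrac12\Lambda q$. Then the Runge-Kutta method applied to the differential-algebraic system $p=-\frac12\Lambda q$, $\dot p=\frac12\Lambda\dot q-DH(q)$ is equivalent to the same Runge-Kutta method applied to the ODE $\Lambda\dot q=DH(q)$. That is, for vectors $Q_i,\dot Q_i$ ($i=1,\dots,s$) and $\bar q$ in $\mathbb{R}^n$, there exist $P^i,\dot P^i$ ($i=1,\dots,s$) and $\bar p$ in $\mathbb{R}^n$ such that $$P^i=-\tfrac12\Lambda Q_i,\quad \dot P^i=\tfrac12\Lambda\dot Q_i-DH(Q_i),\quad Q_i=q+h\sum_{j=1}^s a_{ij}\dot Q_j,\quad P^i=p+h\sum_{j=1}^s a_{ij}\dot P^j\quad(i=1,\dots,s),$$ $$\bar q=q+h\sum_{j=1}^s b_j\dot Q_j,\qquad \bar p=p+h\sum_{j=1}^s b_j\dot P^j$$ if and only if $$\Lambda\dot Q_i=DH(Q_i),\quad Q_i=q+h\sum_{j=1}^s a_{ij}\dot Q_j\quad(i=1,\dots,s),\qquad \bar q=q+h\sum_{j=1}^s b_j\dot Q_j.$$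
   Context: $DH$ denotes the gradient of $H$ (column vector). The dots in $\dot Q_i$, $\dot P^i$ are part of the names of the internal stages of the Runge-Kutta method and do not denote differentiation. $(q,p)$ are the current values and $(\bar q,\bar p)$ the values at the next time step. *)

(* Defs.v *)
From HB Require Import structures.
From mathcomp Require Import all_boot all_order all_algebra.
From mathcomp Require Import all_classical all_reals all_analysis.

Set Implicit Arguments.
Unset Strict Implicit.
Unset Printing Implicit Defensive.

Import Order.TTheory GRing.Theory Num.Theory.
Import numFieldNormedType.Exports.

Local Open Scope classical_set_scope.
Local Open Scope ring_scope.

Definition partial (R : realType) (n : nat) (i : 'I_n)
    (f : 'cV[R]_n -> R) : 'cV[R]_n -> R :=
  fun x => 'D_(delta_mx i 0) f x.

(* 'D_v is a total operator (it has a junk value where the limit does not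
   exist), so iterated_partial is meaningful only together with the existence
   conditions in smooth. *)
Definition iterated_partial (R : realType) (n : nat) (l : seq 'I_n)
    (f : 'cV[R]_n -> R) : 'cV[R]_n -> R :=
  foldr (fun i g => partial i g) f l.

(* C^oo: partial derivatives of all orders exist everywhere and are
   continuous (l = [::] gives the continuity of f itself). *)
Definition smooth (R : realType) (n : nat) (f : 'cV[R]_n -> R) : Prop :=
  forall l : seq 'I_n,
    continuous (iterated_partial l f) /\
    forall (i : 'I_n) (x : 'cV[R]_n),
      derivable (iterated_partial l f) x (delta_mx i 0).

Definition gradient (R : realType) (n : nat) (f : 'cV[R]_n -> R)
    (x : 'cV[R]_n) : 'cV[R]_n :=
  \col_i partial i f x.

(* Main.v *)
(* The constraint gives [P i = - 1/2 Lambda (Q i)] and [p = - 1/2 Lambda q];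
   subtracting [- 1/2 Lambda] times the Q-stage equations from the P-stage
   equations leaves [\sum_j a_ij (Pdot j + 1/2 Lambda (Qdot j)) = 0].  As A is
   invertible, [Pdot j = - 1/2 Lambda (Qdot j)], and the second equation then
   reads [Lambda (Qdot j) = DH (Q j)].  Conversely these formulas define P, Pdot
   and pbar. *)

Require Import Defs.
From HB Require Import structures.
From mathcomp Require Import all_boot all_order all_algebra.
From mathcomp Require Import all_classical all_reals all_analysis.
From mathcomp Require Import lra.

Import Order.TTheory GRing.Theory Num.Theory.
Import numFieldNormedType.Exports.

Local Open Scope ring_scope.

(** Weighting the sums by row [k] of [invmx A] recovers the [k]-th vector, so a family is determined
    by its [A]-combinations. *)
Lemma unitmx_sum_scale_inj (R : comUnitRingType) (V : lmodType R) (s : nat)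
    (A : 'M[R]_s) (u v : 'I_s -> V) :
  A \in unitmx ->
  (forall i, \sum_(j < s) A i j *: u j = \sum_(j < s) A i j *: v j) -> u =1 v.
Proof.
move=> A_unit.
have invA w k : \sum_(i < s) invmx A k i *: (\sum_(j < s) A i j *: w j) = w k :> V.
  under eq_bigr => i _ do rewrite scaler_sumr.
  (* After the exchange, [w j] carries the [(k, j)] entry of [invmx A *m A]: 1 for [j = k], 0
     otherwise. *)
  rewrite exchange_big (bigD1 k) //= [X in _ + X]big1 => [|j neq_jk].
    rewrite addr0; under eq_bigr => i _ do rewrite scalerA.
    have := mulVmx A_unit => /matrixP /(_ k k).
    by rewrite -scaler_suml !mxE eqxx => ->; rewrite scale1r.
  under eq_bigr => i _ do rewrite scalerA.
  have := mulVmx A_unit => /matrixP /(_ k j).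
  by rewrite -scaler_suml !mxE eq_sym (negPf neq_jk) => ->; rewrite scale0r.
by move=> eq_uv k; rewrite -(invA u) -(invA v); apply: eq_bigr => i _; rewrite eq_uv.
Qed.

(** Linear maps commute with Runge-Kutta updates. With [a = - 2^-1] and [L = Lambda], this carries
    the stage equation for [Q] to the one for [P]. *)
Lemma scale_mulmx_step (R : comNzRingType) (m n s : nat) (L : 'M[R]_(m, n))
    (a h : R) (c : 'I_s -> R) (x : 'cV[R]_n) (v : 'I_s -> 'cV[R]_n) :
  a *: (L *m (x + h *: \sum_(j < s) c j *: v j)) =
  a *: (L *m x) + h *: \sum_(j < s) c j *: (a *: (L *m v j)).
Proof.
rewrite mulmxDr scalerDr -scalemxAr mulmx_sumr scalerA mulrC -scalerA scaler_sumr.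
congr (_ + _ *: _); apply: eq_bigr => j _.
by rewrite -scalemxAr !scalerA mulrC.
Qed.

Theorem theorem4p3 (R : realType) (n s : nat)
  (Lambda : 'M[R]_n) (H : 'cV[R]_n -> R) (h : R)
  (A : 'M[R]_s) (b : 'I_s -> R) (q p : 'cV[R]_n)
  (Lambda_inv : Lambda \in unitmx)
  (Lambda_antisym : Lambda^T = - Lambda)
  (H_smooth : smooth H)
  (h_gt0 : 0 < h)
  (A_inv : A \in unitmx)
  (pq : p = - 2^-1 *: (Lambda *m q))
  (Q Qdot : 'I_s -> 'cV[R]_n) (qbar : 'cV[R]_n) :
  (exists (P Pdot : 'I_s -> 'cV[R]_n) (pbar : 'cV[R]_n),
     [/\ forall i : 'I_s,
           [/\ P i = - 2^-1 *: (Lambda *m Q i),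
               Pdot i = 2^-1 *: (Lambda *m Qdot i) - gradient H (Q i),
               Q i = q + h *: \sum_(j < s) A i j *: Qdot j
             & P i = p + h *: \sum_(j < s) A i j *: Pdot j],
         qbar = q + h *: \sum_(j < s) b j *: Qdot j
       & pbar = p + h *: \sum_(j < s) b j *: Pdot j])
  <->
  [/\ forall i : 'I_s,
        Lambda *m Qdot i = gradient H (Q i) /\
        Q i = q + h *: \sum_(j < s) A i j *: Qdot j
    & qbar = q + h *: \sum_(j < s) b j *: Qdot j].
Proof.
have halves (x : 'cV[R]_n) : 2^-1 *: x + 2^-1 *: x = x.
  by rewrite -scalerDl -[RHS]scale1r; congr (_ *: _); lra.
split=> [[P [Pdot [pbar [stages qbarE _]]]]|[stages qbarE]].
  have PdotE : Pdot =1 (fun j => - 2^-1 *: (Lambda *m Qdot j)).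
    apply: (unitmx_sum_scale_inj _ _ _ _ _ _ A_inv) => i.
    have [PiE _ QiE PiE'] := stages i.
    (* Restoring the factor [h] and the term [p] turns both sides into expressions for [P i]. *)
    apply: (scalerI (lt0r_neq0 h_gt0)); apply: (addrI p).
    by rewrite -PiE' PiE QiE scale_mulmx_step -pq.
  split=> // i; have [_ PdotiE QiE _] := stages i; split=> //.
  (* One half of [Lambda *m Qdot i] minus the gradient is [Pdot i], which cancels the other half. *)
  apply/eqP; rewrite -subr_eq0 -[Lambda *m _]halves -addrA -PdotiE PdotE.
  by rewrite scaleNr subrr.
exists (fun i => - 2^-1 *: (Lambda *m Q i)).
exists (fun i => - 2^-1 *: (Lambda *m Qdot i)).
(* Only its own update equation constrains [pbar], so that equation serves as its definition. *)
exists (p + h *: \sum_(j < s) b j *: (- 2^-1 *: (Lambda *m Qdot j))).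
split=> // i; have [gradE QiE] := stages i; split=> //.
  by rewrite -gradE -[X in _ - X]halves opprD addrA subrr add0r scaleNr.
by rewrite {1}QiE scale_mulmx_step -pq.
Qed.
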